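(* For a function $r:(0,\infty)\to(0,\infty)$ the following are equivalent: (i) there exists a Bernstein function $0\ne g\sim(a,b,\mu)$ with $r=r[g]$; (ii) the function $t\mapsto t\,r(t)$ is strictly positive, increasing and concave on $(0,\infty)$. Moreover, if (i) holds with $g\sim(a,b,\mu)$, then: (a) $r$ is continuous and decreasing, with $\lim_{t\to\infty}r(t)=a/2$; (b) $\lim_{t\searrow0}t\,r(t)=b$; (c) $t\mapsto t\,r(t)$ is bounded on $(0,\infty)$ if and only if $a=0$ and there is $h\in\mathcal W^+(\mathbb C_+)$ with $g(z)=z\,h(z)$; in this case $h$ is completely monotone.
   Context: A Bernstein function $g\sim(a,b,\mu)$ is $g(z)=a+bz+\int_{(0,\infty)}(1-e^{-sz})\mu(\mathrm ds)$ with $a,b\ge0$, $\mu$ positive Radon on $(0,\infty)$, $\int\frac{s}{1+s}\mu(\mathrm ds)<\infty$; the triple is unique. Rate function: $r[g](t):=\frac a2+\frac bt+\int_{(0,\infty)}\min(s/t,1)\,\mu(\mathrm ds)$, $t>0$. $\mathcal W^+(\mathbb C_+)$: Laplace transforms of bounded complex Radon measures on $[0,\infty)$. A function $h$ on $(0,\infty)$ is completely monotone if $h\in C^\infty$ and $(-1)^nh^{(n)}\ge0$ for all $n\ge0$. *)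

(* Defs.v *)
From HB Require Import structures.
From mathcomp Require Import all_boot all_order all_algebra.
From mathcomp Require Import all_classical all_reals all_analysis.
From mathcomp Require Import complex.
Set Implicit Arguments. Unset Strict Implicit. Unset Printing Implicit Defensive.
Import Order.TTheory GRing.Theory Num.Theory.
Import numFieldNormedType.Exports.
Local Open Scope classical_set_scope.
Local Open Scope ring_scope.
Local Open Scope complex_scope.

Section Defs.
Variable R : realType.

(* (a,b,mu) is a Bernstein triple: a,b >= 0, mu a positive Borel measure on R
   carried by (0,oo) (mu(]-oo,0]) = 0) with \int s/(1+s) mu(ds) < oo.
   (Such a measure is automatically finite on compacts of (0,oo), i.e. Radon.) *)
Definition bernstein_triple (a b : R) (mu : {measure set R -> \bar R}) : Prop :=
  [/\ 0 <= a, 0 <= b, mu `]-oo, 0%R]%classic = 0%E &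
      (\int[mu]_(s in `]0%R, +oo[%classic) ((s / (1 + s))%:E) < +oo)%E].

Definition bern (a b : R) (mu : {measure set R -> \bar R}) (x : R) : R :=
  a + b * x + fine (\int[mu]_(s in `]0%R, +oo[%classic) ((1 - expR (- (s * x)))%:E)).

(* g(z) for complex z with complex.Re z > 0, written through its real and imaginary
   parts: 1 - e^{-sz} = (1 - e^{-sx} cos(sy)) + i e^{-sx} sin(sy). *)
Definition bernC (a b : R) (mu : {measure set R -> \bar R}) (z : R[i]) : R[i] :=
  let x := complex.Re z in let y := complex.Im z in
  (a + b * x + Rintegral mu `]0%R, +oo[%classic
      (fun s => 1 - expR (- (s * x)) * cos (s * y)))%:C
  + 'i * (b * y + Rintegral mu `]0%R, +oo[%classic
      (fun s => expR (- (s * x)) * sin (s * y)))%:C.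

Definition rate (a b : R) (mu : {measure set R -> \bar R}) (t : R) : R :=
  a / 2 + b / t + fine (\int[mu]_(s in `]0%R, +oo[%classic) ((Num.min (s / t) 1)%:E)).

(* Laplace transform at z (complex.Re z >= 0) of a finite positive measure m on [0,oo):
   \int e^{-sz} m(ds) = \int e^{-sx} cos(sy) m(ds) - i \int e^{-sx} sin(sy) m(ds) *)
Definition laplace (m : {finite_measure set R -> \bar R}) (z : R[i]) : R[i] :=
  let x := complex.Re z in let y := complex.Im z in
  (Rintegral m `[0%R, +oo[%classic (fun s => expR (- (s * x)) * cos (s * y)))%:C
  - 'i * (Rintegral m `[0%R, +oo[%classic (fun s => expR (- (s * x)) * sin (s * y)))%:C.

(* W^+(C_+): Laplace transforms of bounded complex Radon measures on [0,oo).
   A bounded complex measure nu on [0,oo) is written nu = (m1 - m2) + i (m3 - m4)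
   with finite positive Borel measures m1..m4 carried by [0,oo). *)
Definition Wplus (h : R[i] -> R[i]) : Prop :=
  exists m1 m2 m3 m4 : {finite_measure set R -> \bar R},
    [/\ m1 `]-oo, 0%R[%classic = 0%E, m2 `]-oo, 0%R[%classic = 0%E,
        m3 `]-oo, 0%R[%classic = 0%E, m4 `]-oo, 0%R[%classic = 0%E &
        forall z : R[i], 0 <= complex.Re z ->
          h z = laplace m1 z - laplace m2 z + 'i * (laplace m3 z - laplace m4 z)].

Definition completely_monotone (h : R -> R) : Prop :=
  (forall (n : nat) (x : R), 0 < x -> derivable (derive1n n h) x 1) /\
  (forall (n : nat) (x : R), 0 < x -> 0 <= (-1) ^+ n * derive1n n h x).

Definition concave_pos (f : R -> R) : Prop :=
  forall (x y l : R), 0 < x -> 0 < y -> 0 <= l <= 1 ->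
    l * f x + (1 - l) * f y <= f (l * x + (1 - l) * y).

End Defs.

(* Main.v *)
(** With [Phi t = \int min(s, t) mu(ds)] one has [t r(t) = a t / 2 + b + Phi t],
    which is increasing and concave because each [min(s, .)] is.
    Since [r] decreases while [t r(t)] increases, [r] is squeezed into being
    continuous; the two limits are dominated convergence.

    Conversely let [G] be a supergradient of the concave function
    [f t = t r(t)], [c = inf G] and [b = f(0+)].  Pushing Lebesgue measure on
    [(0, oo)] forward along the generalized inverse of [G - c] yields a measure
    [mu] whose tail is [G - c] up to one-sided limits.  The increments of [Phi]
    and of [f t - c t] over [[u, v]] then both lie between [(v - u)(G v - c)] and
    [(v - u)(G u - c)], so refining a partition shows that they agree, and
    letting [u] tend to [0] gives [f t = c t + b + Phi t], i.e. [a = 2 c].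

    [t r(t)] is bounded iff [a = 0] and [\int s mu(ds)] is finite.  Then
    [m = b delta_0 + mu(]u, oo[) du] is finite and Tonelli together with
    [\int_0^s z e^{-uz} du = 1 - e^{-sz}] gives [g(z) = z (L m)(z)]; [L m] is
    completely monotone by differentiation under the integral.  The other
    implication uses [min(v, 1) <= 2 (1 - e^{-v})] at [z = 1 / t]. *)

Require Import Defs.
From HB Require Import structures.
From mathcomp Require Import all_boot all_order all_algebra.
From mathcomp Require Import all_classical all_reals all_analysis.
From mathcomp Require Import complex.
From mathcomp Require Import measurable_realfun.
From mathcomp Require Import ring lra.
Import Order.TTheory GRing.Theory Num.Theory.
Import numFieldNormedType.Exports.
Local Open Scope classical_set_scope.
Local Open Scope ring_scope.
Local Open Scope complex_scope.

(** * Rate functions of Bernstein triples *)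

Section kernel_min.
Context {R : realType}.
Implicit Types (mu : {measure set R -> \bar R}) (s t u v : R).

Local Notation P := (`]0%R, +oo[%classic : set R).

Lemma measurable_min_cst (t : R) (D : set R) : measurable D ->
  measurable_fun D (fun s => Num.min s t).
Proof. by move=> mD; apply: measurable_realfun.measurable_minr. Qed.

Lemma measurable_idD1V : measurable_fun P (fun s : R => s / (1 + s)).
Proof.
apply: open_continuous_measurable_fun => // s.
rewrite inE/= in_itv/= andbT => s0.
apply: cvgM => //; apply: cvgV; first by rewrite gt_eqF// addr_gt0.
by apply: cvgD => //; exact: cvg_cst.
Qed.

(** The triple only makes [s / (1 + s)] integrable, so the integrands [min(s, t)] and [1 - e^{-sx}]
    are compared with this kernel. *)
Lemma bernstein_integrable {a b : R} {mu} {g : R -> R} (C : R) :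
  bernstein_triple a b mu -> measurable_fun P g ->
  (forall s, 0 < s -> `|g s| <= C * (s / (1 + s))) ->
  mu.-integrable P (EFin \o g).
Proof.
move=> [_ _ _ fin] mg gC.
have ik : mu.-integrable P (EFin \o (fun s : R => s / (1 + s))).
  apply/integrableP; split; first by apply/measurable_EFinP; exact: measurable_idD1V.
  rewrite (eq_integral (fun s => (s / (1 + s))%:E))// => s.
  rewrite inE/= in_itv/= andbT => s0; rewrite ger0_norm//.
  by rewrite divr_ge0// ?addr_ge0// ltW.
apply: (le_integrable _ _ _ (integrableZl _ C ik)) => //.
- exact/measurable_EFinP.
- move=> s /=; rewrite in_itv/= andbT => s0; rewrite lee_fin.
  by rewrite (le_trans (gC s s0))// ler_norm.
Qed.

Lemma min_le_kernel s t : 0 < s -> 0 < t -> Num.min s t <= (1 + t) * (s / (1 + s)).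
Proof.
move=> s0 t0; rewrite mulrA ler_pdivlMr ?addr_gt0//.
(* Without denominators this is [s (1 + s) <= (1 + t) s] for [s <= t], and [t + t s <= s + t s]
   otherwise. *)
case: (leP s t) => st; nra.
Qed.

Lemma min_integrable {a b : R} {mu} t : bernstein_triple a b mu -> 0 < t ->
  mu.-integrable P (EFin \o (fun s => Num.min s t)).
Proof.
move=> B t0; apply: (bernstein_integrable (1 + t) B).
  exact: measurable_min_cst.
by move=> s s0; rewrite ger0_norm ?min_le_kernel// le_min !ltW.
Qed.

(** Since [t * min(s / t, 1) = min(s, t)], multiplying by [t] makes the integrand concave and
    increasing in [t]. *)
Lemma rateE {a b : R} {mu} t : bernstein_triple a b mu -> 0 < t ->
  t * rate a b mu t =
  a / 2 * t + b + Rintegral mu P (fun s => Num.min s t).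
Proof.
move=> B t0; rewrite /rate -[fine _]/(Rintegral mu P (fun s => Num.min (s / t) 1)).
have -> : Rintegral mu P (fun s => Num.min s t) =
    t * Rintegral mu P (fun s => Num.min (s / t) 1).
  rewrite -RintegralZl//.
    by apply: eq_Rintegral => s _; rewrite minr_pMr ?ltW// mulr1 mulrC divfK ?gt_eqF.
  apply: (eq_integrable _ (EFin \o (fun s => t^-1 * Num.min s t))) => //.
    by move=> s _ /=; rewrite minr_pMr ?invr_ge0 ?ltW// mulVf ?gt_eqF// mulrC.
  have := integrableZl (measurable_itv `]0%R, +oo[) t^-1 (min_integrable t B t0).
  by [].
by rewrite !mulrDr [t * (b / t)]mulrC divfK ?gt_eqF// [t * _]mulrC.
Qed.

End kernel_min.

(** * Monotonicity, concavity, continuity and limits of the rate *)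

Section rate_properties.
Context {R : realType}.
Implicit Types (mu : {measure set R -> \bar R}) (s t u v : R).

Local Notation P := (`]0%R, +oo[%classic : set R).

Lemma integral_min_le {a b : R} {mu} s t : bernstein_triple a b mu -> 0 < s -> s <= t ->
  Rintegral mu P (fun u => Num.min u s) <= Rintegral mu P (fun u => Num.min u t).
Proof.
move=> B s0 st; apply: le_Rintegral => //.
- exact: min_integrable B s0.
- exact: min_integrable B (lt_le_trans s0 st).
- by move=> u _; rewrite le_min2.
Qed.

Lemma concave_min (u x y l : R) : 0 <= l <= 1 ->
  l * Num.min u x + (1 - l) * Num.min u y <= Num.min u (l * x + (1 - l) * y).
Proof.
move=> /andP[l0 l1]; rewrite le_min; apply/andP; split.
  have: Num.min u x <= u by rewrite ge_min lexx.
  have: Num.min u y <= u by rewrite ge_min lexx.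
  nra.
have: Num.min u x <= x by rewrite ge_min lexx orbT.
have: Num.min u y <= y by rewrite ge_min lexx orbT.
nra.
Qed.

Lemma concave_integral_min {a b : R} {mu} : bernstein_triple a b mu ->
  concave_pos (fun t => Rintegral mu P (fun u => Num.min u t)).
Proof.
move=> B x y l x0 y0 /[dup] l01 /andP[l0 l1].
have z0 : 0 < l * x + (1 - l) * y by nra.
have ix := integrableZl (measurable_itv `]0%R, +oo[) l (min_integrable x B x0).
have iy := integrableZl (measurable_itv `]0%R, +oo[) (1 - l) (min_integrable y B y0).
rewrite -!RintegralZl//; [|exact: min_integrable B _..].
rewrite -RintegralD//; apply: le_Rintegral => //.
- exact: (integrableD _ ix iy).
- exact: min_integrable B z0.
- by move=> u _; exact: concave_min.
Qed.

Lemma concave_rate {a b : R} {mu} : bernstein_triple a b mu ->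
  concave_pos (fun t => t * rate a b mu t).
Proof.
move=> B x y l x0 y0 l01; have /andP[l0 l1] := l01.
have z0 : 0 < l * x + (1 - l) * y by nra.
rewrite !(rateE _ B)//; have /= := concave_integral_min B x y l x0 y0 l01; lra.
Qed.

Lemma mul_rate_le {a b : R} {mu} s t : bernstein_triple a b mu -> 0 < s -> s <= t ->
  s * rate a b mu s <= t * rate a b mu t.
Proof.
move=> B s0 st; have t0 := lt_le_trans s0 st.
rewrite !(rateE _ B)// lerD// ?integral_min_le//; last exact: integral_min_le B _ _.
by rewrite lerD2r ler_wpM2l// divr_ge0//; case: B.
Qed.

(** The integrand [min(v / u, 1)] decreases in [u]; it is written as [u^-1 * min(v, u)] to inherit
    integrability from [min_integrable]. *)
Lemma rate_le {a b : R} {mu} s t : bernstein_triple a b mu -> 0 < s -> s <= t ->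
  rate a b mu t <= rate a b mu s.
Proof.
move=> B s0 st; have t0 := lt_le_trans s0 st.
have /(_ _)/= rE u : 0 < u -> rate a b mu u = a / 2 + b / u +
    u^-1 * Rintegral mu P (fun v => Num.min v u).
  move=> u0; apply: (mulfI (lt0r_neq0 u0)); rewrite (rateE _ B)//.
  by field; rewrite gt_eqF.
rewrite !rE// -!RintegralZl//; [|exact: min_integrable B _..].
have b0 : 0 <= b by case: B.
apply: lerD; first by rewrite lerD2l ler_wpM2l// lef_pV2.
apply: le_Rintegral => //.
- exact: (integrableZl _ t^-1 (min_integrable t B t0)).
- exact: (integrableZl _ s^-1 (min_integrable s B s0)).
- move=> u; rewrite /= in_itv/= andbT => u0.
  rewrite !minr_pMr ?invr_ge0 ?(ltW s0) ?(ltW t0)// !mulVf ?gt_eqF//.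
  by apply: le_min2 => //; rewrite ler_wpM2r ?lef_pV2// ltW.
Qed.

(** On either side of [x], [f y] lies between [f x] and [f x * x / y], and the latter tends to
    [f x]. *)
Lemma continuous_of_nonincreasing_nondecreasingM {f : R -> R} (x : R) : 0 < x ->
  (forall s t, 0 < s -> s <= t -> f t <= f s) ->
  (forall s t, 0 < s -> s <= t -> s * f s <= t * f t) ->
  {for x, continuous f}.
Proof.
move=> x0 dec inc.
have : x * f x / y @[y --> x] --> x * f x / x.
  by apply: cvgM; [exact: cvg_cst|apply: cvgV => //; rewrite gt_eqF].
rewrite [x * f x]mulrC mulfK ?gt_eqF// => /cvgrPdist_le cvx.
apply/cvgrPdist_le => e e0; near=> y.
have y0 : 0 < y by near: y; exact: lt_nbhsr.
have: `|f x - f x * x / y| <= e by near: y; exact: cvx.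
apply: le_trans; have [xy|/ltW yx] := leP x y.
  have d := dec _ _ x0 xy; have i := inc _ _ x0 xy.
  have : f x * x / y <= f y by rewrite ler_pdivrMr// mulrC [f y * y]mulrC.
  by move=> h; rewrite !ger0_norm ?subr_ge0 ?(le_trans h)// lerB.
have d := dec _ _ y0 yx; have i := inc _ _ y0 yx.
have h : f y <= f x * x / y by rewrite ler_pdivlMr// mulrC [f x * x]mulrC.
by rewrite !ler0_norm ?subr_le0 ?(le_trans d)// !opprB lerB.
Unshelve. all: end_near. Qed.

Lemma Rintegral_cvg0 {mu} {g_ : nat -> R -> R} (G : R -> R) :
  (forall n, measurable_fun P (g_ n)) -> mu.-integrable P (EFin \o G) ->
  (forall s, 0 < s -> g_ n s @[n --> \oo] --> 0) ->
  (forall n s, 0 < s -> `|g_ n s| <= G s) ->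
  Rintegral mu P (g_ n) @[n --> \oo] --> 0.
Proof.
move=> mg iG g0 gG; rewrite /Rintegral.
rewrite -[X in _ --> X]/(fine (0%:E)); apply: fine_cvg.
have -> : (0%:E = \int[mu]_(x in P) (cst 0 x))%E by rewrite integral0.
have mP : measurable P by exact: measurable_itv.
have [] := @dominated_convergence _ _ _ mu P mP (fun n x => (g_ n x)%:E) (cst 0%E) (EFin \o G).
- by move=> n; exact/measurable_EFinP.
- exact: measurable_cst.
- apply: aeW => s; rewrite /= in_itv/= andbT => s0.
  by apply: cvg_EFin; [exact: nearW|exact: g0].
- exact: iG.
- by apply: aeW => s n; rewrite /= in_itv/= andbT => s0; rewrite lee_fin gG.
by move=> _ _.
Qed.

Lemma cvg_integral_min0 {a b : R} {mu} : bernstein_triple a b mu ->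
  Rintegral mu P (fun s => Num.min s t) @[t --> 0^'+] --> 0.
Proof.
move=> B; apply/cvg_at_rightP => u [u0 ucvg].
(* A convergent sequence is bounded; the positive bound [|M + 1| + 1] yields one dominating function
   for all [n]. *)
have [M [_ /(_ (M + 1))]] := cvg_seq_bounded (cvgP _ ucvg).
rewrite ltrDl ltr01 => /(_ isT) uM.
have uM' n : u n <= `|M + 1| + 1.
  have /= := uM n I; have := ler_norm (u n); have := ler_norm (M + 1); lra.
have M1 : 0 < `|M + 1| + 1 by rewrite ltr_wpDl.
apply: (Rintegral_cvg0 (fun s => Num.min s (`|M + 1| + 1))).
- by move=> n; exact: measurable_min_cst.
- exact: min_integrable B _.
- move=> s s0; apply: (@squeeze_cvgr _ _ _ _ (cst 0) u) => //; last exact: cvg_cst.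
  by apply: nearW => n; rewrite ge_min lexx orbT le_min (ltW s0) (ltW (u0 n)).
- by move=> n s s0; rewrite ger0_norm ?le_min2// le_min !ltW.
Qed.

Lemma cvg_mul_rate_at_right {a b : R} {mu} : bernstein_triple a b mu ->
  t * rate a b mu t @[t --> 0^'+] --> b.
Proof.
move=> B; have: (a / 2 * t + b + Rintegral mu P (fun s => Num.min s t)) @[t --> 0^'+]
    --> a / 2 * 0 + b + 0.
  apply: cvgD; last exact: cvg_integral_min0 B.
  apply: cvgD; last exact: cvg_cst.
  by apply: cvgM; [exact: cvg_cst|exact: cvg_at_right_filter].
rewrite mulr0 add0r addr0; apply: cvg_trans; apply: near_eq_cvg.
near=> t; rewrite (rateE _ B)//; near: t; exact: nbhs_right_gt.
Unshelve. all: end_near. Qed.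

Lemma cvg_rate_pinfty {a b : R} {mu} : bernstein_triple a b mu ->
  rate a b mu t @[t --> +oo] --> a / 2.
Proof.
move=> B; apply/cvg_pinftyP => u ucvg.
have cV : (u n)^-1 @[n --> \oo] --> 0.
  apply/gtr0_cvgV0 => //; near=> n; apply: (lt_le_trans ltr01).
  by near: n; move/cvgryPge : ucvg; apply.
rewrite -[X in _ --> X]addr0; apply: cvgD.
  rewrite -[X in _ --> X]addr0; apply: cvgD; first exact: cvg_cst.
  by rewrite -(mulr0 b); apply: cvgM => //; exact: cvg_cst.
(* Replacing the terms below [1] makes [s / v n <= s] hold for every [n], as domination requires;
   eventually [v n = u n]. *)
pose v n := if 1 <= u n then u n else 1.
have v1 n : 1 <= v n by rewrite /v; case: ifP.
have : Rintegral mu P (fun s => Num.min (s / v n) 1) @[n --> \oo] --> 0.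
  apply: (Rintegral_cvg0 (fun s => Num.min s 1)).
  - move=> n; apply: measurable_realfun.measurable_minr => //.
    exact: measurable_funM.
  - exact: min_integrable B _.
  - move=> s s0; have cs : s / v n @[n --> \oo] --> 0.
      rewrite -(mulr0 s); apply: cvgM; first exact: cvg_cst.
      apply: cvg_trans cV; apply: near_eq_cvg; near=> n; rewrite /v.
      suff -> : 1 <= u n by [].
      by near: n; move/cvgryPge : ucvg; apply.
    apply: (@squeeze_cvgr _ _ _ _ (cst 0) (fun n => s / v n)) => //.
      apply: nearW => n; have v0 := lt_le_trans ltr01 (v1 n).
      by rewrite ge_min lexx andbT le_min ler01 andbT divr_ge0 ?(ltW s0) ?(ltW v0).
    exact: cvg_cst.
  - move=> n s s0; have v0 := lt_le_trans ltr01 (v1 n).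
    rewrite ger0_norm; last by rewrite le_min ler01 andbT divr_ge0 ?(ltW s0) ?(ltW v0).
    by apply: le_min2 => //; rewrite ler_pdivrMr// ler_peMr// ltW.
apply: cvg_trans; apply: near_eq_cvg; near=> n; rewrite /v.
suff -> : 1 <= u n by [].
by near: n; move/cvgryPge : ucvg; apply.
Unshelve. all: end_near. Qed.

End rate_properties.

(** * Concave functions as integrals of truncations *)

Section concave_representation.
Context {R : realType}.
Implicit Types (f G H : R -> R) (s t u v w c : R).

(* On the uniform partition into [n + 1] pieces the bounds telescope to
   [(G u - G v) (v - u) / (n + 1)]. *)
Lemma eq_of_increment_bound {H G} {u v} : u <= v ->
  (forall x y, u <= x -> x <= y -> y <= v ->
     `|H y - H x| <= (G x - G y) * (y - x)) ->
  H u = H v.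
Proof.
move=> uv HG.
pose x (n k : nat) := u + (v - u) * (k%:R / n.+1%:R).
have bound n k : (k <= n.+1)%N ->
    `|H (x n k) - H u| <= (G u - G (x n k)) * ((v - u) / n.+1%:R).
  have x0 : x n 0 = u by rewrite /x mul0r mulr0 addr0.
  have xS j : x n j.+1 = x n j + (v - u) / n.+1%:R.
    by rewrite /x -[j.+1%:R]natr1; ring.
  have d0 : 0 <= (v - u) / n.+1%:R by rewrite divr_ge0// subr_ge0.
  elim: k => [_|k IH kn]; first by rewrite x0 !subrr normr0 mul0r.
  have xu : u <= x n k by rewrite lerDl mulr_ge0// ?subr_ge0// divr_ge0.
  have xv : x n k.+1 <= v.
    rewrite -lerBrDl ler_piMr ?subr_ge0// ler_pdivrMr// mul1r ler_nat//.
  have xx : x n k <= x n k.+1 by rewrite xS lerDl.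
  have := HG _ _ xu xx xv; have := IH (ltnW kn).
  have -> : x n k.+1 - x n k = (v - u) / n.+1%:R by rewrite xS addrC addKr.
  move=> h1 h2; have -> : H (x n k.+1) - H u =
    (H (x n k.+1) - H (x n k)) + (H (x n k) - H u) by ring.
  apply: le_trans (ler_normD _ _) _; apply: le_trans (lerD h2 h1) _.
  by rewrite -mulrDl le_eqVlt; apply/orP; left; apply/eqP; ring.
apply/eqP; rewrite eq_sym -subr_eq0 -normr_eq0; apply: contraT => D0.
have {}D0 : 0 < `|H v - H u| by rewrite lt0r D0 normr_ge0.
pose C := (G u - G v) * (v - u).
(* With this many pieces [bound] forces [n + 1 <= C / |H v - H u|], contrary to the choice of
   [n]. *)
pose n := Num.truncn (C / `|H v - H u|).
have := bound n n.+1 (leqnn _).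
have -> : x n n.+1 = v by rewrite /x divff ?pnatr_eq0// mulr1 addrC subrK.
rewrite mulrA -/C ler_pdivlMr ?ltr0n//.
rewrite mulrC -ler_pdivlMr// => le.
by have := le_lt_trans le (truncnS_gt (C / `|H v - H u|)); rewrite ltxx.
Qed.

Lemma concave_three_points f u v w : concave_pos f -> 0 < u -> u < v -> v < w ->
  (w - v) * f u + (v - u) * f w <= (w - u) * f v.
Proof.
move=> cf u0 uv vw; have uw := lt_trans uv vw.
have wu : 0 < w - u by rewrite subr_gt0.
have l01 : 0 <= (w - v) / (w - u) <= 1.
  apply/andP; split; first by rewrite divr_ge0// ?subr_ge0 ltW.
  by rewrite ler_pdivrMr// mul1r lerD2l lerN2 ltW.
have := cf u w _ u0 (lt_trans u0 uw) l01.
have -> : (w - v) / (w - u) * u + (1 - (w - v) / (w - u)) * w = v.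
  by field; rewrite gt_eqF.
rewrite -(ler_pM2l wu); apply: le_trans; rewrite le_eqVlt; apply/orP; left.
by apply/eqP; field; rewrite gt_eqF.
Qed.

(** [G u] is the supremum of the secant slopes starting at [u]. By concavity any slope ending at [v]
    bounds all slopes starting at [v], which gives both inequalities. *)
Lemma concave_supergradient f : concave_pos f ->
  exists G : R -> R, forall u v, 0 < u -> u < v ->
    G v * (v - u) <= f v - f u <= G u * (v - u).
Proof.
move=> cf; pose slopes u := [set (f v - f u) / (v - u) | v in [set v | u < v]].
have slope_le u v w : 0 < u -> u < v -> v < w ->
    (f w - f v) / (w - v) <= (f v - f u) / (v - u).
  move=> u0 uv vw; rewrite ler_pdivrMr ?subr_gt0// mulrAC ler_pdivlMr ?subr_gt0//.
  by have := concave_three_points f u v w cf u0 uv vw; lra.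
have slopes0 u : slopes u !=set0.
  by exists ((f (u + 1) - f u) / (u + 1 - u)), (u + 1) => //=; rewrite ltrDl.
have slopes_ub u v : 0 < u -> u < v -> ubound (slopes v) ((f v - f u) / (v - u)).
  by move=> u0 uv _ [w vw <-]; exact: slope_le.
exists (fun u => sup (slopes u)) => u v u0 uv.
have vu : 0 < v - u by rewrite subr_gt0.
rewrite -(ler_pdivlMr _ _ vu) -(ler_pdivrMr _ _ vu); apply/andP; split.
  by apply: ge_sup => //; exact: slopes_ub.
apply: ub_le_sup; last by exists v.
(* Any point of [(0, u)] would do: its secant to [u] bounds [slopes u]. *)
by exists ((f u - f (u / 2)) / (u - u / 2)); apply: slopes_ub; lra.
Qed.

(* [mu] is the image of Lebesgue measure on [(0, oo)] under the generalized
   inverse [y |-> sup {u > 0 | c + y < G u}], which is [0] (the junk value of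
   [sup set0]) for large [y]; that mass at [0] is discarded by the restriction. *)
Lemma tail_measure {G} {c} :
  (forall u v, 0 < u -> u <= v -> G v <= G u) ->
  (forall u, 0 < u -> c <= G u) ->
  (forall e, 0 < e -> exists2 u, 0 < u & G u < c + e) ->
  exists mu : {measure set R -> \bar R},
    [/\ mu `]-oo, 0%R]%classic = 0%E,
        forall u, 0 < u -> (mu `]u, +oo[%classic <= (G u - c)%:E)%E &
        forall u, 0 < u -> ((G u - c)%:E <= mu `[u, +oo[%classic)%E].
Proof.
move=> Gdec cG Ginf.
pose A y := [set u | 0 < u /\ c + y < G u].
have Aub y : 0 < y -> has_ubound (A y).
  move=> /Ginf[u0 u00 Gu0]; exists u0 => u [up yu]; rewrite leNgt; apply/negP => uu.
  by have := Gdec _ _ u00 (ltW uu); lra.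
pose S y := sup (A y).
have Sdec y z : 0 < y -> y <= z -> S z <= S y.
  (* If [A z] is empty then [S z] is the default value [0], so [S y] must be known to be
     nonnegative. *)
  move=> y0 yz; have S0 : 0 <= S y.
    have [Ay0|/set0P[u yu]] := eqVneq (A y) set0; first by rewrite /S Ay0 sup0.
    have [u0 _] := yu; apply: le_trans (ltW u0) _.
    by apply: ub_le_sup => //; exact: Aub.
  have [z0|/set0P[u zu]] := eqVneq (A z) set0; first by rewrite [S z]/S z0 sup0.
  apply: ge_sup; first by exists u.
  move=> w [w0 zw]; apply: ub_le_sup; first exact: Aub.
  by split=> //; apply: le_lt_trans zw; rewrite lerD2l.
(* For [y < 0] the set [A y] is unbounded; setting [T] to [0] off [(0, oo)] keeps only Lebesgue
   measure on [(0, oo)]. *)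
pose T := S \_ `]0%R, +oo[.
have mT : measurable_fun [set: R] T.
  apply/(measurable_restrict S) => //; rewrite setTI.
  apply: (measurability (@RGenCInfty.G R)) => [|/= _ [_] [r] -> <-].
    exact: RGenCInfty.measurableE.
  (* [S] is nonincreasing on [(0, oo)], so its superlevel sets there are intervals. *)
  apply: is_interval_measurable => s t/=.
  rewrite !in_itv/= !andbT => -[s0 rs] [t0 rt] w /andP[sw wt].
  have w0 := lt_le_trans s0 sw; split; rewrite in_itv/= andbT//.
  by rewrite (le_trans rt)// Sdec.
have mTA A' : measurable A' -> measurable (T @^-1` A').
  by move=> mA'; rewrite -[X in measurable X]setTI; exact: mT.
pose mu0 : {measure set R -> \bar R} :=
  measure_function_pushforward__canonical__measure_function_Measure (@lebesgue_measure R) mT.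
have mP : measurable (`]0%R, +oo[%classic : set R) by exact: measurable_itv.
pose mu : {measure set R -> \bar R} := mrestr mu0 mP.
have muE A0 : mu A0 = lebesgue_measure (T @^-1` (A0 `&` `]0%R, +oo[%classic)) by [].
exists mu; split.
- rewrite muE (_ : _ `&` _ = set0) ?preimage_set0 ?measure0//.
  by apply/seteqP; split => x //= []; rewrite !in_itv/= andbT leNgt => /negP.
- move=> u u0; rewrite muE.
  have Gu : 0 <= G u - c by rewrite subr_ge0 cG.
  (* [u < T y] provides [w > u] with [c + y < G w <= G u], so the preimage of the tail lies in []0,
     G u - c]]. *)
  apply: (@le_trans _ _ (lebesgue_measure (`]0%R, (G u - c)%R]%classic : set R))); last first.
    by rewrite lebesgue_measure_itv/= lte_fin; case: ifPn; rewrite ?sube0// lee_fin.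
  apply: le_measure; rewrite ?inE//.
    by apply: mTA; exact: measurableI.
  move=> y/=; rewrite !in_itv/= !andbT => -[uT _].
  move: uT; rewrite /T patchE; case: ifPn => [|_ /lt_trans-/(_ _ u0)]; last by rewrite ltxx.
  rewrite inE/= in_itv/= andbT => y0 uS; rewrite y0/=.
  have [Ay0|/set0P Ay0] := eqVneq (A y) set0.
    by move: uS; rewrite /S Ay0 sup0 => /lt_trans-/(_ _ u0); rewrite ltxx.
  have [w [w0 yw] uw] := sup_gt Ay0 uS.
  have := Gdec _ _ u0 (ltW uw); lra.
- move=> u u0; rewrite muE.
  have [Gu|Gu] := leP (G u - c) 0; first by rewrite (@le_trans _ _ 0%E)// lee_fin.
  have -> : ((G u - c)%:E = lebesgue_measure (`]0%R, (G u - c)%R[%classic : set R))%E.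
    by rewrite lebesgue_measure_itv/= lte_fin Gu sube0.
  (* Here [y < G u - c] puts [u] itself in [A y], whence [u <= T y]. Equality can occur, so the tail
     has to be closed. *)
  apply: le_measure; rewrite ?inE//.
    by apply: mTA; exact: measurableI.
  move=> y/=; rewrite !in_itv/= !andbT => /andP[y0 yG].
  suff uT : u <= T y by split => //; exact: lt_le_trans uT.
  rewrite /T patchE mem_set/= ?in_itv/= ?y0//.
  apply: ub_le_sup; first exact: Aub.
  by split=> //; rewrite -ltrBrDl.
Qed.

Local Notation P := (`]0%R, +oo[%classic : set R).

(** The integrand vanishes for [s <= u] and equals [v - u] for [s >= v], so it lies between [v - u]
    times the indicators of [[v, oo[] and of []u, oo[]. *)
Lemma integral_min_increment {mu : {measure set R -> \bar R}} {u v g h : R} :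
  0 < u -> u <= v ->
  (mu `]u, +oo[%classic <= g%:E)%E -> (h%:E <= mu `[v, +oo[%classic)%E ->
  (((v - u) * h)%:E <= \int[mu]_(s in P) (Num.min s v - Num.min s u)%:E <=
   ((v - u) * g)%:E)%E.
Proof.
move=> u0 uv ug hv; have vu : 0 <= v - u by rewrite subr_ge0.
have mk : measurable_fun P (fun s => (Num.min s v - Num.min s u)%:E).
  by apply/measurable_EFinP; apply: measurable_funB; exact: measurable_min_cst.
have k0 s : 0 <= Num.min s v - Num.min s u by rewrite subr_ge0 le_min2.
have I (A : set R) : measurable A -> A `<=` P ->
    (\int[mu]_(s in P) ((v - u)%:E * (\1_A s)%:E) = (v - u)%:E * mu A)%E.
  move=> mA AP; rewrite ge0_integralZl_EFin//; last first.
    by apply/measurable_EFinP; exact: measurable_indic.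
  by rewrite integral_indic// (setIidl AP).
have mi (A : set R) : measurable A -> measurable_fun P (fun s => (v - u)%:E * (\1_A s)%:E)%E.
  move=> mA; apply: emeasurable_funM => //.
  by apply/measurable_EFinP; exact: measurable_indic.
apply/andP; split.
  apply: (@le_trans _ _ ((v - u)%:E * mu `[v, +oo[%classic)%E).
    by rewrite EFinM lee_wpmul2l// lee_fin.
  rewrite -I//; last first.
    by move=> s/=; rewrite !in_itv/= !andbT; apply: lt_le_trans; exact: lt_le_trans u0 uv.
  apply: ge0_le_integral => //.
  - by move=> s _; rewrite -EFinM lee_fin mulr_ge0// indicE.
  - exact: mi.
  - move=> s _; rewrite -EFinM lee_fin indicE; case: (boolP (s \in _)); last by rewrite mulr0.
    rewrite inE/= in_itv/= andbT mulr1 => vs.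
    by rewrite (min_idPr vs) (min_idPr (le_trans uv vs)).
apply: (@le_trans _ _ ((v - u)%:E * mu `]u, +oo[%classic)%E); last first.
  by rewrite EFinM lee_wpmul2l// lee_fin.
rewrite -I//; last first.
  by move=> s/=; rewrite !in_itv/= !andbT; exact: lt_trans.
apply: ge0_le_integral => //.
- by move=> s _; rewrite lee_fin.
- exact: mi.
- move=> s _; rewrite -EFinM lee_fin indicE; case: (boolP (s \in _)).
    rewrite inE/= in_itv/= andbT mulr1 => us.
    by rewrite (min_idPr (ltW us)) lerD2r ge_min lexx orbT.
  rewrite notin_setE/= in_itv/= andbT mulr0 => /negP; rewrite -leNgt => su.
  by rewrite (min_idPl su) (min_idPl (le_trans su uv)) subrr.
Qed.

(** On [[x, y]] the integral and the increment of [F] obey the same two bounds, whose gap is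
    [(G x - G y) * (y - x)] as [c] cancels. [eq_of_increment_bound] applies to their difference. *)
Lemma integral_min_of_tail {F G : R -> R} {mu : {measure set R -> \bar R}} {c u v} :
  (forall x y, 0 < x -> x < y -> (y - x) * (G y - c) <= F y - F x <= (y - x) * (G x - c)) ->
  (forall x, 0 < x -> (mu `]x, +oo[%classic <= (G x - c)%:E)%E) ->
  (forall x, 0 < x -> ((G x - c)%:E <= mu `[x, +oo[%classic)%E) ->
  0 < u -> u <= v ->
  (\int[mu]_(s in P) (Num.min s v - Num.min s u)%:E = (F v - F u)%:E)%E.
Proof.
move=> FG muG Gmu u0 uv.
pose I x y := (\int[mu]_(s in P) (Num.min s y - Num.min s x)%:E)%E.
have Ib x y : 0 < x -> x <= y ->
    (((y - x) * (G y - c))%:E <= I x y <= ((y - x) * (G x - c))%:E)%E.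
  move=> x0 xy; apply: integral_min_increment => //; first exact: muG.
  by apply: Gmu; exact: lt_le_trans x0 xy.
have Ifin x y : 0 < x -> x <= y -> I x y \is a fin_num.
  move=> x0 xy; have /andP[l r] := Ib x y x0 xy.
  by rewrite fin_numElt (lt_le_trans _ l) ?ltNyr// (le_lt_trans r) ?ltry.
have Iint x y : 0 < x -> x <= y ->
    mu.-integrable P (EFin \o (fun s => Num.min s y - Num.min s x)).
  move=> x0 xy; apply/integrableP; split.
    apply/measurable_EFinP; apply: measurable_funB; exact: measurable_min_cst.
  rewrite (eq_integral (fun s => (Num.min s y - Num.min s x)%:E)).
    by have := Ifin x y x0 xy; rewrite fin_numElt => /andP[].
  by move=> s _; rewrite /= ger0_norm// subr_ge0 le_min2.
have I0 x : I x x = 0%E.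
  by rewrite /I (eq_integral (cst 0%E)) ?integral0// => s _; rewrite subrr.
suff : fine (I u u) - F u = fine (I u v) - F v.
  rewrite I0/= => h; rewrite -[LHS]fineK ?Ifin//; congr EFin; rewrite -/(I u v); lra.
apply: (@eq_of_increment_bound (fun x => fine (I u x) - F x) G) => // x y ux xy yv.
have x0 := lt_le_trans u0 ux.
have -> : fine (I u y) = fine (I u x) + fine (I x y).
  have := RintegralD (measurable_itv `]0%R, +oo[) (Iint u x u0 ux) (Iint x y x0 xy).
  rewrite /Rintegral => <-; congr fine; apply: eq_integral => s _; congr EFin; ring.
have [xy'|yx] := ltP x y; last first.
  have -> : y = x by apply/eqP; rewrite eq_le xy yx.
  by rewrite I0 /= addr0 !subrr mul0r normr0.
have := FG x y x0 xy'; have := Ib x y x0 xy; rewrite -(fineK (Ifin x y x0 xy)) !lee_fin.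
rewrite ler_norml; set J := fine (I x y); set A := (y - x) * _; set B := (y - x) * _.
have -> : (G x - G y) * (y - x) = B - A by rewrite /A /B; ring.
by move=> /andP[? ?] /andP[? ?]; rewrite /=; apply/andP; split; lra.
Qed.

Lemma concave_rate_representation {f : R -> R} :
  (forall t, 0 < t -> 0 < f t) -> (forall s t, 0 < s -> s <= t -> f s <= f t) ->
  concave_pos f ->
  exists (a b : R) (mu : {measure set R -> \bar R}), bernstein_triple a b mu /\
    forall t, 0 < t -> f t = t * rate a b mu t.
Proof.
move=> f0 finc /concave_supergradient[G Gf].
have Gdec u v : 0 < u -> u <= v -> G v <= G u.
  rewrite le_eqVlt => u0 /predU1P[->//|uv]; have /andP[] := Gf u v u0 uv.
  by move=> h1 h2; have := le_trans h1 h2; rewrite ler_pM2r// subr_gt0.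
have G0 u : 0 < u -> 0 <= G u.
  move=> u0; have uu : u < u + 1 by rewrite ltrDl.
  have /andP[_] := Gf u (u + 1) u0 uu.
  have -> : u + 1 - u = 1 by ring.
  rewrite mulr1; apply: le_trans; rewrite subr_ge0 finc// lerDl//.
pose GS : set R := [set G u | u in [set u | 0 < u]].
have GS0 : GS !=set0 by exists (G 1), 1 => /=.
have GSlb : lbound GS 0 by move=> _ [u/= u0 <-]; exact: G0.
pose c := inf GS.
have cG u : 0 < u -> c <= G u.
  by move=> u0; apply: ge_inf; [exists 0|exists u].
have c0 : 0 <= c by exact: lb_le_inf.
have cinf e : 0 < e -> exists2 u, 0 < u & G u < c + e.
  move=> e0; have : c < c + e by rewrite ltrDl.
  by move=> /(inf_lt GS0)[_ [u u0 <-] h]; exists u.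
have [mu [muN muG Gmu]] := tail_measure Gdec cG cinf.
(* As [f] increases, this infimum is the right limit of [f] at [0]. *)
pose b := inf [set f t | t in `]0, +oo[%classic].
have flb : lbound [set f t | t in `]0, +oo[%classic] 0.
  by move=> y [t /=]; rewrite in_itv/= andbT => t0 <-; rewrite ltW// f0.
have b0 : 0 <= b.
  by apply: lb_le_inf => //; exists (f 1), 1 => //=; rewrite in_itv/= andbT.
have fb : f x @[x --> 0^'+] --> b.
  apply: nondecreasing_at_right_cvgr => //; last by exists 0.
  by move=> x y; rewrite !in_itv/= !andbT => x0 y0; exact: finc.
pose F x := f x - c * x.
have FG x y : 0 < x -> x < y ->
    (y - x) * (G y - c) <= F y - F x <= (y - x) * (G x - c).
  move=> x0 xy; have /andP[] := Gf x y x0 xy; rewrite /F.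
  by move=> ? ?; apply/andP; split; lra.
have minE v : 0 < v -> (\int[mu]_(s in P) (Num.min s v)%:E = (F v - b)%:E)%E.
  (* The lower end [u] of the increment formula runs through [x n], which decreases to [0]; monotone
     convergence then yields the integral of [min(s, v)]. *)
  move=> v0; pose x n := v / n.+1%:R.
  have x0 n : 0 < x n by rewrite divr_gt0.
  have xv n : x n <= v by rewrite ler_pdivrMr// ler_peMr ?ler1n// ltW.
  have xdec n m : (n <= m)%N -> x m <= x n.
    by move=> nm; rewrite ler_pM2l// lef_pV2 ?posrE// ler_nat.
  have xcvg : x n @[n --> \oo] --> 0.
    rewrite -(mulr0 v); apply: cvgM; first exact: cvg_cst.
    exact: cvg_harmonic.
  have := @cvg_monotone_convergence _ _ _ mu P (measurable_itv _)
    (fun n s => (Num.min s v - Num.min s (x n))%:E).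
  have -> : (\int[mu]_(s in P) limn (fun n => (Num.min s v - Num.min s (x n))%:E) =
      \int[mu]_(s in P) (Num.min s v)%:E)%E.
    apply: eq_integral => s; rewrite inE/= in_itv/= andbT => s0.
    apply/cvg_lim => //; apply: cvg_EFin; first exact: nearW.
    rewrite -[X in _ --> X]subr0; apply: cvgB; first exact: cvg_cst.
    apply: (@squeeze_cvgr _ _ _ _ (cst 0) x) => //; last exact: cvg_cst.
    by apply: nearW => n; rewrite ge_min lexx orbT le_min (ltW s0) (ltW (x0 n)).
  move=> lim; apply: (cvg_unique _ (lim _ _ _)) => //.
  - move=> n; apply/measurable_EFinP.
    by apply: measurable_funB; exact: measurable_min_cst.
  - by move=> n s _; rewrite lee_fin subr_ge0 le_min2.
  - by move=> s _ n m nm; rewrite lee_fin lerB// le_min2// xdec.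
  - suff : (F v - F (x n))%:E @[n --> \oo] --> (F v - b)%:E.
      apply: cvg_trans; apply: near_eq_cvg; apply: nearW => n.
      by rewrite (integral_min_of_tail FG muG Gmu).
    apply: cvg_EFin; first exact: nearW.
    apply: cvgB; first exact: cvg_cst.
    rewrite -[X in _ --> X]subr0; apply: cvgB.
      by have /cvg_at_rightP := fb; apply.
    by rewrite -(mulr0 c); apply: cvgM => //; exact: cvg_cst.
(* The factor [2] offsets the [a / 2] in [rate]. Finiteness follows from [s / (1 + s) <= min(s, 1)]
   and [minE] at [1]. *)
have B : bernstein_triple (2 * c) b mu.
  split => //; first by rewrite mulr_ge0.
  apply: (@le_lt_trans _ _ (\int[mu]_(s in P) (Num.min s 1)%:E)%E); last by rewrite minE// ltry.
  apply: ge0_le_integral => //.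
  - by move=> s /=; rewrite in_itv/= andbT => s0; rewrite lee_fin divr_ge0// ltW// addr_gt0.
  - by apply/measurable_EFinP; exact: measurable_idD1V.
  - by apply/measurable_EFinP; exact: measurable_min_cst.
  - move=> s /=; rewrite in_itv/= andbT => s0; rewrite lee_fin le_min.
    have s1 : 0 < 1 + s by rewrite addr_gt0.
    by apply/andP; split; rewrite ler_pdivrMr//; nra.
exists (2 * c), b, mu; split=> // t t0; rewrite (rateE _ B)// /Rintegral minE//= /F.
by field.
Qed.

End concave_representation.

(** * The Laplace representation of g(z) / z *)

Section laplace_of_tail.
Context {R : realType}.
Implicit Types (mu : {measure set R -> \bar R}) (s t u v : R).

Local Notation P := (`]0%R, +oo[%classic : set R).
Local Notation P0 := (`[0%R, +oo[%classic : set R).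
Local Notation leb := (@lebesgue_measure R).

(** Split [D] along [E]: the restricted measure agrees with [mu] inside [E] and is zero outside. *)
Lemma ge0_integral_mrestr {d} {T : measurableType d} (mu : {measure set T -> \bar R})
    {E D : set T} (mE : measurable E) (f : T -> \bar R) :
  measurable D -> measurable_fun D f -> (forall x, D x -> 0%R <= f x)%E ->
  (\int[mrestr mu mE]_(x in D) f x = \int[mu]_(x in D `&` E) f x)%E.
Proof.
move=> mD mf f0.
have mDE : measurable (D `&` E) by exact: measurableI.
have mDE' : measurable (D `\` E) by exact: measurableD.
have DE : D = (D `&` E) `|` (D `\` E) by rewrite setUIDK.
rewrite [in LHS]DE ge0_integral_setU//; last 3 first.
- by rewrite -DE.
- by rewrite -DE.
- by apply/disj_setPS => x [[_ Ex] [_ /(_ Ex)]].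
rewrite (eq_measure_integral mu); last first.
  by move=> A mA AD; rewrite /mrestr/=; congr (mu _); apply/setIidl => x /AD[].
rewrite [X in (_ + X)%E](eq_measure_integral mzero); last first.
  move=> A mA AD; change (mu (A `&` E) = 0%E); rewrite (_ : A `&` E = set0) ?measure0//.
  by apply/seteqP; split => // x [/AD[]].
by rewrite integral_measure_zero adde0.
Qed.

(** By Markov's inequality each set where [s / (1 + s) >= 1 / (n + 1)] has finite measure. They
    exhaust [(0, oo)], and the rest is null. Tonelli relies on this. *)
Lemma bernstein_sigma_finite {a b : R} {mu} : bernstein_triple a b mu ->
  sigma_finite setT mu.
Proof.
move=> [_ _ mu0 fin].
pose k s : R := s / (1 + s).
exists (fun n => `]-oo, 0%R]%classic `|` (P `&` [set s | n.+1%:R^-1%:E <= `|(k s)%:E|]%E)).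
  apply/seteqP; split => // s _.
  have [s0|s0] := leP s 0; first by exists 0%N => //=; left; rewrite in_itv.
  have k0 : 0 < k s by rewrite divr_gt0// addr_gt0.
  exists (Num.truncn (k s)^-1) => //=; right; split; first by rewrite in_itv/= s0.
  rewrite lee_fin ger0_norm ?(ltW k0)// invf_ple ?posrE ?ltr0n// ltW//.
  exact: truncnS_gt.
move=> n.
have mk : measurable_fun P (EFin \o k) by apply/measurable_EFinP; exact: measurable_idD1V.
have mA : measurable (P `&` [set s | n.+1%:R^-1%:E <= `|(k s)%:E|]%E).
  by apply: emeasurable_fun_c_infty => //; exact: measurableT_comp.
have mN : measurable (`]-oo, 0%R]%classic : set R) by exact: measurable_itv.
split; first exact: measurableU.
apply: (le_lt_trans (measureU2 mu mN mA)); rewrite [X in (X + _)%E]mu0 add0e.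
have := @le_integral_abse _ _ _ mu P (measurable_itv _) _ n.+1%:R^-1 mk.
rewrite invr_gt0 ltr0n => /(_ isT)/= le.
have fin' : (\int[mu]_(x in P) `|k x|%:E < +oo)%E.
  rewrite (eq_integral (fun s => (k s)%:E))// => s.
  by rewrite inE/= in_itv/= andbT => s0; rewrite ger0_norm// divr_ge0// ltW// addr_gt0.
rewrite ltNge leye_eq; apply/negP => /eqP h.
by have := le_lt_trans le fin'; rewrite h gt0_muley ?lte_fin ?invr_gt0// ltxx.
Qed.

(* [m] is [b delta_0 + mu([u, oo[) du], realized as the second marginal of
   [mu \x Lebesgue] restricted to [{(s, u) | 0 <= u <= s}]. *)
Lemma tail_mixture (mu : {sigma_finite_measure set R -> \bar R}) (b : R) : 0 <= b ->
  exists m : {measure set R -> \bar R},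
    m `]-oo, 0%R[%classic = 0%E /\
    forall g : R -> \bar R, measurable_fun setT g ->
      (forall u : R, (0 <= u)%R -> (0 <= g u)%E) ->
      (\int[m]_(u in P0) g u =
       b%:E * g 0%R + \int[mu]_(s in P) \int[leb]_(u in `[0%R, s]) g u)%E.
Proof.
move=> b0.
pose T : measurableType _ := (R * measurableTypeR R)%type.
have msnd : measurable_fun [set: T] (snd : T -> R) by exact: measurable_snd.
have mfst : measurable_fun [set: T] (fst : T -> R) by exact: measurable_fst.
pose E : set T := [set p | 0 < p.1 /\ 0 <= p.2 <= p.1].
have mE : measurable E.
  rewrite (_ : E = (setT `&` (fst : T -> R) @^-1` P) `&` (setT `&` (snd : T -> R) @^-1` P0) `&`
      (setT `&` (fun p : T => (p.1 : R) - (p.2 : R)) @^-1` P0)); last first.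
    apply/seteqP; split => -[x y]/=; rewrite !in_itv/= !andbT subr_ge0.
      by move=> [x0 /andP[]].
    by move=> [[[_ x0] [_ y0]] [_ yx]]; split=> //=; rewrite y0.
  have mB : measurable_fun setT (fun p : T => (p.1 : R) - (p.2 : R)).
    by apply: measurable_funB; [exact: mfst|exact: msnd].
  by apply: measurableI; [apply: measurableI|];
    [exact: mfst|exact: msnd|exact: mB].
have mS : measurable ((snd : T -> R) @^-1` P0) by rewrite -[X in measurable X]setTI; exact: msnd.
pose pi : {measure set T -> \bar R} := (mu \x leb)%E.
pose nu0 : {measure set T -> \bar R} := mrestr pi mE.
pose nu : {measure set R -> \bar R} :=
  measure_function_pushforward__canonical__measure_function_Measure nu0 msnd.
pose m : {measure set R -> \bar R} :=
  measure_add (mscale (NngNum b0) (@dirac _ R 0%R R)) nu.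
exists m; split.
  have -> : m `]-oo, 0%R[%classic =
      (b%:E * (@dirac _ R 0%R R) `]-oo, 0%R[%classic + nu `]-oo, 0%R[%classic)%E.
    exact: measure_addE.
  rewrite diracE memNset/= ?in_itv/= ?ltxx//.
  rewrite mule0 add0e /pushforward /nu0/= /mrestr.
  rewrite (_ : _ `&` _ = set0) ?measure0//; apply/seteqP; split => // -[x y]/=.
  by rewrite in_itv/= => -[y0 [_ /andP[/le_lt_trans-/(_ _ y0)]]]; rewrite ltxx.
move=> g mg g0.
have gP0 x : P0 x -> (0 <= g x)%E by rewrite /= in_itv/= andbT; exact: g0.
have mg0 : measurable_fun P0 g by exact: measurable_funTS.
rewrite /m ge0_integral_measure_add//=.
congr (_ + _)%E.
  rewrite ge0_integral_mscale//= integral_dirac// diracE mem_set ?mul1e//.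
  by rewrite /= in_itv/= lexx.
rewrite ge0_integral_pushforward//; last by move=> x; rewrite inE; exact: gP0.
rewrite ge0_integral_mrestr//; last 2 first.
  by apply: measurableT_comp => //; exact: measurable_funTS.
  by move=> x /gP0.
have -> : (snd : T -> R) @^-1` P0 `&` E = E.
  by apply/setIidr => -[x y] [/= _ /andP[y0 _]]; rewrite in_itv/= y0.
(* Tonelli: the section of [E] at [s] is [[0, s]] for [s > 0] and empty otherwise. *)
rewrite integral_mkcond fubini_tonelli1; last 2 first.
  apply/(measurable_restrict _) => //; rewrite setTI.
  by apply: measurable_funTS; exact: measurableT_comp.
  by apply: erestrict_ge0 => -[x y] [/= _ /andP[y0 _]]; exact: g0.
rewrite [RHS]integral_mkcond; apply: eq_integral => s _.
rewrite /fubini_F patchE; case: ifPn => sP; last first.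
  apply: integral0_eq => u _; rewrite patchE memNset// => -[/= s0 _].
  by move/negP : sP; apply; rewrite inE/= in_itv/= s0.
rewrite [RHS]integral_mkcond; apply: eq_integral => u _; rewrite !patchE.
suff -> : ((s, u) \in E) = (u \in `[0%R, s]%classic) by [].
move: sP; rewrite inE/= in_itv/= andbT => s0.
by apply/idP/idP; rewrite !inE/= in_itv/=; [case|move=> h; split].
Qed.

End laplace_of_tail.

(** * Integrals of derivatives against the tail measure *)

Section laplace_representation.
Context {R : realType}.
Implicit Types (mu : {measure set R -> \bar R}) (s t u v : R).

Local Notation P := (`]0%R, +oo[%classic : set R).
Local Notation P0 := (`[0%R, +oo[%classic : set R).
Local Notation leb := (@lebesgue_measure R).

Lemma is_derive_continuous {F g : R -> R} :
  (forall u, is_derive u 1 F (g u)) -> continuous F.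
Proof.
move=> Fg u; apply: differentiable_continuous; apply/derivable1_diffP.
by have [] := Fg u.
Qed.

Lemma integral_primitive {F g : R -> R} s : continuous g ->
  (forall u, is_derive u 1 F (g u)) -> 0 < s ->
  (\int[leb]_(u in `[0%R, s]) (g u)%:E = (F s - F 0)%:E)%E.
Proof.
move=> cg Fg s0; rewrite (@continuous_FTC2 _ g F)// ?EFinB//.
- exact: continuous_subspaceT.
- have cF := is_derive_continuous Fg; split.
  + by move=> x _; have [] := Fg x.
  + by apply: cvg_at_right_filter; exact: cF.
  + by apply: cvg_at_left_filter; exact: cF.
- by move=> x _; rewrite derive1E; have [_ ->] := Fg x.
Qed.

Lemma continuous_bounded_integrable (m : {finite_measure set R -> \bar R})
    {h : R -> R} C : continuous h -> (forall u, 0 <= u -> `|h u| <= C) ->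
  m.-integrable P0 (EFin \o h).
Proof.
move=> ch hC; apply: measurable_bounded_integrable => //.
- by rewrite ltey_eq fin_num_measure.
- by apply: measurable_funTS; exact: continuous_measurable_fun.
- exists C; split; first exact: num_real.
  by move=> x Cx u; rewrite /= in_itv/= andbT => u0; apply: le_trans (hC u u0) (ltW Cx).
Qed.

(** With a primitive [F] of [g], the inner integral over [[0, s]] in [tail_mixture] is [F s - F 0].
    One [m] serves all [g], so the real and imaginary parts of [z e^{-uz}] can be treated
    separately. *)
Lemma tail_laplace {a b : R} {mu} : bernstein_triple a b mu ->
  mu.-integrable P (EFin \o (fun s => s)) ->
  exists m : {finite_measure set R -> \bar R},
    m `]-oo, 0%R[%classic = 0%E /\
    forall (F g : R -> R) (M : R), continuous g ->
      (forall u, is_derive u 1 F (g u)) -> (forall u, 0 <= u -> `|g u| <= M) ->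
      Rintegral m P0 g = b * g 0 + Rintegral mu P (fun s => F s - F 0).
Proof.
move=> B imu; have b0 : 0 <= b by case: B.
have sf := bernstein_sigma_finite B.
pose H1 := isSFinite.Build _ _ _ _ (sfinite_measure_sigma_finite sf).
pose H2 := isSigmaFinite.Build _ _ _ _ sf.
pose smu := HB.pack_for (SigmaFiniteMeasure.type R R) (Measure.sort mu) H1 H2.
have [m0 [m0N m0E]] := tail_mixture smu b b0.
have mcont (g : R -> R) (D : set R) : measurable D -> continuous g -> measurable_fun D g.
  by move=> mD cg; apply: measurable_funTS; exact: continuous_measurable_fun.
have pos (F g : R -> R) : continuous g -> (forall u, is_derive u 1 F (g u)) ->
    (forall u, 0 <= u -> 0 <= g u) ->
    (\int[m0]_(u in P0) (g u)%:E = (b * g 0)%:E + \int[mu]_(s in P) (F s - F 0)%:E)%E.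
  move=> cg Fg g0; rewrite m0E; last 2 first.
  - by apply/measurable_EFinP; exact: mcont.
  - by move=> u u0; rewrite lee_fin g0.
  congr (_ + _)%E; apply: eq_integral => s; rewrite inE/= in_itv/= andbT => s0.
  exact: integral_primitive.
have id1 (c u : R) : is_derive u 1 (fun v => c * v) c.
  by apply: is_derive_eq; rewrite [_ *: _]mulr1.
have ccst (c : R) : continuous (cst c : R -> R) by move=> u; exact: cvg_cst.
(* Taking [g = 1] shows that the total mass is [b] plus the integral of [s], finite by [imu]. *)
have m0P : (m0 P0 < +oo)%E.
  have := pos (fun u => 1 * u) (cst 1) (ccst 1) (id1 1) (fun _ _ => ler01).
  rewrite -[X in (X = _)%E]/(\int[m0]_(u in P0) (cst 1%E u))%E integral_cst//= mul1e => ->.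
  rewrite lte_add_pinfty ?ltry//.
  have /(integrable_lty (measurable_itv _)) := imu; congr (_ < _)%E.
  by apply: eq_integral => s _ /=; rewrite mulr0 subr0 mul1r.
have m0T : fin_num_fun m0.
  move=> A mA; rewrite ge0_fin_numE ?measure_ge0//.
  apply: (@le_lt_trans _ _ (m0 (`]-oo, 0%R[%classic `|` P0))).
    apply: le_measure; rewrite ?inE//; first exact: measurableU.
    by move=> x _; rewrite /= !in_itv/= andbT; case: (ltP x 0) => _; [left|right].
  apply: (le_lt_trans (measureU2 m0 (measurable_itv _) (measurable_itv _))).
  by rewrite [X in (X + _)%E]m0N add0e.
have sf0 : sigma_finite setT m0 by apply: fin_num_fun_sigma_finite; rewrite ?measure0.
pose H3 := isFinite.Build _ _ _ _ m0T.
pose H4 := isSFinite.Build _ _ _ _ (sfinite_measure_sigma_finite sf0).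
pose H5 := isSigmaFinite.Build _ _ _ _ sf0.
pose m := HB.pack_for (FiniteMeasure.type R R) (Measure.sort m0) H3 H4 H5.
exists m; split => // F g M cg Fg gM.
have iP := continuous_bounded_integrable m.
have M0 : 0 <= M by apply: le_trans (gM 0 _); rewrite ?normr_ge0.
have gM0 u : 0 <= u -> 0 <= g u + M by move=> /gM; rewrite ler_norml; lra.
have cgM : continuous (fun u => g u + M) by move=> u; apply: cvgD; [exact: cg|exact: cvg_cst].
have FgM u : is_derive u 1 (fun v => F v + M * v) (g u + M).
  by apply: is_deriveD.
have igM : m.-integrable P0 (EFin \o (fun u => g u + M)).
  apply: (iP _ (M + M)) => // u u0; apply: le_trans (ler_normD _ _) _.
  by rewrite lerD ?gM// ger0_norm.
have icM : m.-integrable P0 (EFin \o cst M).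
  by apply: (iP _ M) => // u u0; rewrite /= ger0_norm.
have E1 := pos _ _ cgM FgM gM0.
have E2 : (\int[m0]_(u in P0) (cst M u)%:E = (b * M)%:E + \int[mu]_(s in P) (M * s - M * 0)%:E)%E.
  exact: pos.
have iMs : mu.-integrable P (EFin \o (fun s => M * s - M * 0)).
  have := integrableZl (measurable_itv `]0%R, +oo[) M imu.
  by apply: eq_integrable => // s _ /=; rewrite mulr0 subr0.
have F0 s : 0 < s -> 0 <= F s + M * s - (F 0 + M * 0).
  move=> s0; rewrite -lee_fin -(integral_primitive s cgM FgM s0).
  by apply: integral_ge0 => u; rewrite /= in_itv/= => /andP[u0 _]; rewrite lee_fin gM0.
have iF : mu.-integrable P (EFin \o (fun s => F s + M * s - (F 0 + M * 0))).
  apply/integrableP; split.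
    apply/measurable_EFinP; apply: measurable_funB => //.
    by apply: mcont => //; exact: is_derive_continuous FgM.
  rewrite (eq_integral (fun s => (F s + M * s - (F 0 + M * 0))%:E)); last first.
    by move=> s; rewrite inE/= in_itv/= andbT => s0; rewrite ger0_norm ?F0.
  (* Finiteness is read off [E1], whose left-hand side is the integral of a bounded function against
     a finite measure. *)
  rewrite ltNge leye_eq; apply/negP => /eqP Y.
  have /(integrable_lty (measurable_itv _)) := igM.
  by have -> := E1; rewrite Y addey.
(* [pos] only covers nonnegative integrands: write [g = (g + M) - M]. *)
have -> : Rintegral m P0 g = Rintegral m P0 (fun u => g u + M) - Rintegral m P0 (cst M).
  by rewrite -RintegralB//; apply: eq_Rintegral => u _; rewrite /= addrK.
have -> : Rintegral mu P (fun s => F s - F 0) =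
    Rintegral mu P (fun s => F s + M * s - (F 0 + M * 0)) -
    Rintegral mu P (fun s => M * s - M * 0).
  by rewrite -RintegralB//; apply: eq_Rintegral => u _ /=; ring.
rewrite /Rintegral; have -> := E1; have -> := E2.
have fM := integrable_fin_num (measurable_itv _) iMs.
have fF := integrable_fin_num (measurable_itv _) iF.
by rewrite (fineD _ fM)// (fineD _ fF)//=; ring.
Qed.

End laplace_representation.

(** * The factorization [g(z) = z (L m)(z)] for complex [z] *)

Section laplace_complex.
Context {R : realType}.
Implicit Types (mu : {measure set R -> \bar R}) (s t u v x y : R).

Local Notation P := (`]0%R, +oo[%classic : set R).
Local Notation P0 := (`[0%R, +oo[%classic : set R).

(* The real and imaginary parts of [d/du (- e^{-uz}) = z e^{-uz}], [z = x + i y]. *)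
Lemma is_derive_exp_cos x y u :
  is_derive u 1 (fun v => - (expR (- (v * x)) * cos (v * y)))
    (x * (expR (- (u * x)) * cos (u * y)) + y * (expR (- (u * x)) * sin (u * y))).
Proof.
by apply: is_derive_eq; rewrite /GRing.scale/=; ring.
Qed.

Lemma is_derive_exp_sin x y u :
  is_derive u 1 (fun v => expR (- (v * x)) * sin (v * y))
    (y * (expR (- (u * x)) * cos (u * y)) + - x * (expR (- (u * x)) * sin (u * y))).
Proof.
by apply: is_derive_eq; rewrite /GRing.scale/=; ring.
Qed.

Lemma expRN_le1 x u : 0 <= x -> 0 <= u -> `|expR (- (u * x))| <= 1.
Proof. by move=> x0 u0; rewrite ger0_norm ?expR_ge0// -expR0 ler_expR oppr_le0 mulr_ge0. Qed.

Lemma expRN_cos_le1 x y u : 0 <= x -> 0 <= u -> `|expR (- (u * x)) * cos (u * y)| <= 1.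
Proof.
by move=> x0 u0; rewrite normrM -[leRHS]mulr1 ler_pM ?expRN_le1// cos_max.
Qed.

Lemma expRN_sin_le1 x y u : 0 <= x -> 0 <= u -> `|expR (- (u * x)) * sin (u * y)| <= 1.
Proof.
by move=> x0 u0; rewrite normrM -[leRHS]mulr1 ler_pM ?expRN_le1// sin_max.
Qed.

Lemma continuous_exp_cos x y : continuous (fun u => expR (- (u * x)) * cos (u * y)).
Proof.
move=> u; apply: cvgM.
  apply: continuous_comp; last exact: continuous_expR.
  by apply: cvgN; apply: cvgM; [exact: cvg_id|exact: cvg_cst].
apply: (continuous_comp (f := fun v => v * y)); last exact: continuous_cos.
by apply: cvgM; [exact: cvg_id|exact: cvg_cst].
Qed.

Lemma continuous_exp_sin x y : continuous (fun u => expR (- (u * x)) * sin (u * y)).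
Proof.
move=> u; apply: cvgM.
  apply: continuous_comp; last exact: continuous_expR.
  by apply: cvgN; apply: cvgM; [exact: cvg_id|exact: cvg_cst].
apply: (continuous_comp (f := fun v => v * y)); last exact: continuous_sin.
by apply: cvgM; [exact: cvg_id|exact: cvg_cst].
Qed.

(** Writing [L m = C - i S], the product with [x + i y] has real part [x C + y S] and imaginary part
    [y C - x S]; [tail_laplace] computes each of them. *)
Lemma bernC_laplace {b : R} {mu} : bernstein_triple 0 b mu ->
  mu.-integrable P (EFin \o (fun s => s)) ->
  exists m : {finite_measure set R -> \bar R},
    m `]-oo, 0%R[%classic = 0%E /\
    forall z : R[i], 0 < complex.Re z -> bernC 0 b mu z = z * laplace m z.
Proof.
move=> B imu; have [m [mN mE]] := tail_laplace B imu.
exists m; split => // -[x y] /= x0.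
pose C := Rintegral m P0 (fun s => expR (- (s * x)) * cos (s * y)).
pose S := Rintegral m P0 (fun s => expR (- (s * x)) * sin (s * y)).
have bint := continuous_bounded_integrable m.
have ic := bint _ 1 (continuous_exp_cos x y) (fun u => expRN_cos_le1 x y u (ltW x0)).
have isn := bint _ 1 (continuous_exp_sin x y) (fun u => expRN_sin_le1 x y u (ltW x0)).
have ECS (p q : R) : Rintegral m P0 (fun u =>
    p * (expR (- (u * x)) * cos (u * y)) + q * (expR (- (u * x)) * sin (u * y))) =
    p * C + q * S.
  rewrite RintegralD//; last 2 first.
    exact: (integrableZl _ p ic).
    exact: (integrableZl _ q isn).
  by rewrite !RintegralZl.
have bnd (p q u : R) : 0 <= u ->
    `|p * (expR (- (u * x)) * cos (u * y)) + q * (expR (- (u * x)) * sin (u * y))| <=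
    `|p| + `|q|.
  move=> u0; apply: le_trans (ler_normD _ _) _; apply: lerD; rewrite normrM ler_piMr//.
    by apply: expRN_cos_le1 => //; exact: ltW.
  by apply: expRN_sin_le1 => //; exact: ltW.
have cont (p q : R) : continuous (fun u =>
    p * (expR (- (u * x)) * cos (u * y)) + q * (expR (- (u * x)) * sin (u * y))).
  move=> u; apply: cvgD; apply: cvgM; first exact: cvg_cst.
  - exact: continuous_exp_cos.
  - exact: cvg_cst.
  - exact: continuous_exp_sin.
have := mE _ _ _ (cont x y) (is_derive_exp_cos x y) (bnd x y).
rewrite ECS !mul0r oppr0 expR0 cos0 sin0 !mulr0 !mulr1 addr0 => E1.
have := mE _ _ _ (cont y (- x)) (is_derive_exp_sin x y) (bnd y (- x)).
rewrite ECS !mul0r oppr0 expR0 cos0 sin0 !mulr0 !mulr1 addr0 => E2.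
have {}E1 : b * x + Rintegral mu P (fun s => 1 - expR (- (s * x)) * cos (s * y)) =
    x * C + y * S.
  by rewrite E1; congr (_ + _); apply: eq_Rintegral => s _; ring.
have {}E2 : b * y + Rintegral mu P (fun s => expR (- (s * x)) * sin (s * y)) =
    y * C - x * S.
  by rewrite -mulNr E2; congr (_ + _); apply: eq_Rintegral => s _; rewrite subr0.
rewrite /bernC /laplace /= -/C -/S add0r E1 E2 -complexiE.
apply/eqP; rewrite eq_complex /=; apply/andP; split; apply/eqP; ring.
Qed.

End laplace_complex.

(** * Bounded t r(t) *)

Section bounded_rate.
Context {R : realType}.
Implicit Types (mu : {measure set R -> \bar R}) (s t u v x y : R).

Local Notation P := (`]0%R, +oo[%classic : set R).
Local Notation P0 := (`[0%R, +oo[%classic : set R).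

Lemma bounded_rate_integrable {a b : R} {mu} {M : R} : bernstein_triple a b mu ->
  (forall t, 0 < t -> t * rate a b mu t <= M) ->
  a = 0 /\ mu.-integrable P (EFin \o (fun s => s)).
Proof.
move=> B rM; have [a0 b0 _ _] := B.
pose Phi t := Rintegral mu P (fun s => Num.min s t).
have Phi0 t : 0 < t -> 0 <= Phi t.
  move=> t0; apply: Rintegral_ge0 => s; rewrite /= in_itv/= andbT => s0.
  by rewrite le_min !ltW.
have {}rM t : 0 < t -> a / 2 * t + b + Phi t <= M.
  by move=> t0; rewrite -(rateE _ B)//; exact: rM.
have M0 : 0 <= M.
  have := rM 1 ltr01; apply: le_trans; rewrite mulr1.
  by rewrite !addr_ge0// ?divr_ge0// Phi0.
split.
  apply/eqP; rewrite eq_le a0 andbT leNgt; apply/negP => ap.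
  (* At this [t] the linear term alone equals [M + 1], and the other terms are nonnegative. *)
  have t0 : 0 < 2 * (M + 1) / a by rewrite divr_gt0// mulr_gt0// ltr_wpDl.
  have := rM _ t0; have := Phi0 _ t0.
  have -> : a / 2 * (2 * (M + 1) / a) = M + 1 by field; rewrite gt_eqF.
  lra.
apply/integrableP; split.
  by apply/measurable_EFinP; exact: measurable_id.
rewrite (eq_integral (fun s => s%:E)); last first.
  by move=> s; rewrite inE/= in_itv/= andbT => s0; rewrite ger0_norm// ltW.
apply: (@le_lt_trans _ _ M%:E); last exact: ltry.
(* Truncation at [n + 1] keeps the level positive, so that [rM] applies; monotone convergence then
   bounds the integral of [s] by [M]. *)
pose k n s : \bar R := (Num.min s n.+1%:R)%:E.
have mk n : measurable_fun P (k n).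
  by apply/measurable_EFinP; exact: measurable_min_cst.
have k0 n s : P s -> (0 <= k n s)%E.
  by rewrite /= in_itv/= andbT => s0; rewrite lee_fin le_min (ltW s0) ler0n.
have kdec s : P s -> {homo k^~ s : n m / (n <= m)%N >-> (n <= m)%E}.
  by move=> _ n m nm; rewrite lee_fin le_min2// ler_nat.
have := cvg_monotone_convergence (measurable_itv `]0%R, +oo[) mk k0 kdec (mu := mu).
have -> : (\int[mu]_(s in P) limn (k^~ s) =
    \int[mu]_(s in P) s%:E)%E.
  apply: eq_integral => s _.
  apply/cvg_lim => //; apply: cvg_EFin; first exact: nearW.
  apply: cvg_near_cst; near=> n; apply/min_idPl.
  apply: (@le_trans _ _ n%:R); last by rewrite ler_nat.
  by near: n; exact: nbhs_infty_ger.
move=> lim; rewrite -(cvg_lim _ lim)//.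
apply: lime_le; first by apply: cvgP lim.
apply: nearW => n.
have i := min_integrable n.+1%:R B (ltr0Sn _ _).
rewrite -(fineK (integrable_fin_num (measurable_itv _) i)) lee_fin.
have := rM n.+1%:R (ltr0Sn _ _); apply: le_trans.
by rewrite lerDr addr_ge0// mulr_ge0// divr_ge0.
Unshelve. all: end_near. Qed.

(** From [e^v >= 1 + v] one gets [1 - e^{-v} >= v / (1 + v)], which is at least half of
    [min(v, 1)]. *)
Lemma min_le_2M1BexpR v : 0 <= v -> Num.min v 1 <= 2 * (1 - expR (- v)).
Proof.
move=> v0; have v1 : 0 < 1 + v by rewrite ltr_pwDl.
have : expR (- v) <= (1 + v)^-1.
  by rewrite expRN lef_pV2 ?posrE ?expR_gt0// expR_ge1Dx.
have : 1 - (1 + v)^-1 = v / (1 + v) by field; rewrite gt_eqF.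
suff : Num.min v 1 <= 2 * (v / (1 + v)) by lra.
rewrite mulrA ler_pdivlMr//; case: (leP v 1); nra.
Qed.

Lemma integrable_1BexpR {a b : R} {mu} x : bernstein_triple a b mu -> 0 < x ->
  mu.-integrable P (EFin \o (fun s => 1 - expR (- (s * x)))).
Proof.
move=> B x0; apply: (bernstein_integrable (1 + x) B).
  apply: measurable_funTS; apply: continuous_measurable_fun => s.
  apply: cvgB; first exact: cvg_cst.
  apply: (continuous_comp (f := fun v => - (v * x))); last exact: continuous_expR.
  by apply: cvgN; apply: cvgM; [exact: cvg_id|exact: cvg_cst].
move=> s s0; have sx : 0 < s * x by rewrite mulr_gt0.
rewrite ger0_norm; last by rewrite subr_ge0 -expR0 ler_expR oppr_le0 ltW.
(* The constant [1 + x] comes from adding [1 - e^{-sx} <= s x] and [s (1 - e^{-sx}) <= s]. *)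
have := expR_ge1Dx (- (s * x)); have := expR_ge0 (- (s * x)).
rewrite mulrA ler_pdivlMr ?addr_gt0//; nra.
Qed.

(** It serves twice: to bound [t r(t)] by [h], and to see that a positive rate excludes [g = 0]. *)
Lemma rate_le_bern {a b : R} {mu} t : bernstein_triple a b mu -> 0 < t ->
  rate a b mu t <= 2 * bern a b mu t^-1.
Proof.
move=> B t0; have [a0 b0 _ _] := B; have t0' : 0 < t^-1 by rewrite invr_gt0.
rewrite /rate /bern.
rewrite -[fine _]/(Rintegral mu P (fun s => Num.min (s / t) 1)).
rewrite -[X in 2 * (_ + X)]/(Rintegral mu P (fun s => 1 - expR (- (s * t^-1)))).
have i1 := integrable_1BexpR t^-1 B t0'.
have i2 := integrableZl (measurable_itv `]0%R, +oo[) 2 i1.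
have : Rintegral mu P (fun s => Num.min (s / t) 1) <=
    2 * Rintegral mu P (fun s => 1 - expR (- (s * t^-1))).
  rewrite -RintegralZl//; apply: le_Rintegral => //.
    have := integrableZl (measurable_itv `]0%R, +oo[) t^-1 (min_integrable t B t0).
    apply: eq_integrable => // s _ /=.
    by rewrite -EFinM minr_pMr ?(ltW t0')// mulVf ?gt_eqF// mulrC.
  move=> s; rewrite /= in_itv/= andbT => s0.
  by apply: min_le_2M1BexpR; rewrite divr_ge0 ?ltW.
have : 0 <= b / t by rewrite divr_ge0// ltW.
lra.
Qed.

Lemma laplace_real (m : {finite_measure set R -> \bar R}) x :
  laplace m x%:C = (Rintegral m P0 (fun s => expR (- (s * x))))%:C.
Proof.
rewrite /laplace /= (@eq_Rintegral _ _ _ _ _ (fun s => expR (- (s * x)))); last first.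
  by move=> s _; rewrite mulr0 cos0 mulr1.
rewrite [X in 'i * X%:C](@eq_Rintegral _ _ _ _ _ (cst 0)); last first.
  by move=> s _; rewrite mulr0 sin0 mulr0.
have -> : Rintegral m P0 (cst 0) = 0.
  by rewrite /Rintegral integral0.
by rewrite mulr0 subr0.
Qed.

Lemma bernC_real (a b : R) mu x :
  bernC a b mu x%:C = (bern a b mu x)%:C.
Proof.
rewrite /bernC /bern /=.
rewrite (@eq_Rintegral _ _ _ _ _ (fun s => 1 - expR (- (s * x)))); last first.
  by move=> s _; rewrite mulr0 cos0 mulr1.
rewrite [X in 'i * (_ + X)%:C](@eq_Rintegral _ _ _ _ _ (cst 0)); last first.
  by move=> s _; rewrite mulr0 sin0 mulr0.
have -> : Rintegral mu P (cst 0) = 0.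
  by rewrite /Rintegral integral0.
by rewrite mulr0 addr0 mulr0 addr0.
Qed.

Lemma laplace_real_bounds (m : {finite_measure set R -> \bar R}) x : 0 < x ->
  0 <= Rintegral m P0 (fun s => expR (- (s * x))) <= Rintegral m P0 (cst 1).
Proof.
move=> x0; apply/andP; split.
  by apply: Rintegral_ge0 => s _; exact: expR_ge0.
apply: le_Rintegral => //.
- apply: (continuous_bounded_integrable m 1) => [|u u0]; last by rewrite expRN_le1// ltW.
  move=> s; apply: (continuous_comp (f := fun v => - (v * x))); last exact: continuous_expR.
  by apply: cvgN; apply: cvgM; [exact: cvg_id|exact: cvg_cst].
- apply: (continuous_bounded_integrable m 1) => [u|u _]; first exact: cvg_cst.
  by rewrite normr1.
- move=> s; rewrite /= in_itv/= andbT => s0.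
  by apply: le_trans (ler_norm _) _; apply: expRN_le1 => //; exact: ltW.
Qed.

(** On the positive axis all four transforms are real, so [Re h] is that of [m1] minus that of [m2],
    hence at most the mass of [m1]. *)
Lemma Wplus_bounded {h : R[i] -> R[i]} : Wplus h ->
  exists M, forall x, 0 < x -> complex.Re (h x%:C) <= M.
Proof.
move=> [m1 [m2 [m3 [m4 [_ _ _ _ hE]]]]].
exists (Rintegral m1 P0 (cst 1)) => x x0.
rewrite hE; last exact: ltW.
rewrite !laplace_real -complexiE /=.
have /andP[_ h1] := laplace_real_bounds m1 x x0.
have /andP[h2 _] := laplace_real_bounds m2 x x0.
by lra.
Qed.

Lemma Wplus_laplace (m : {finite_measure set R -> \bar R}) :
  m `]-oo, 0%R[%classic = 0%E -> Wplus (laplace m).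
Proof.
move=> m0; pose z0 : {finite_measure set R -> \bar R} :=
  [the {finite_measure set R -> \bar R} of mzero].
(* The imaginary part is the null difference [m - m]. *)
exists m, z0, m, m; split=> // z _; rewrite subrr mulr0 addr0.
have z0E (f : R -> R) : Rintegral z0 P0 f = 0.
  by rewrite /Rintegral integral_measure_zero.
by rewrite [laplace z0 z]/laplace !z0E mulr0 !subr0.
Qed.

(** At [z = 1 / t] the factorization reads [t g(1 / t) = h(1 / t)], so [t r(t) <= 2 Re h(1 / t)]. *)
Lemma bounded_rate_of_Wplus {b : R} {mu} {h : R[i] -> R[i]} :
  bernstein_triple 0 b mu -> Wplus h ->
  (forall z : R[i], 0 < complex.Re z -> bernC 0 b mu z = z * h z) ->
  exists M, forall t, 0 < t -> t * rate 0 b mu t <= M.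
Proof.
move=> B /Wplus_bounded[M hM] gh; exists (2 * M) => t t0.
have t0' : 0 < t^-1 by rewrite invr_gt0.
have := rate_le_bern t B t0; have := hM _ t0'.
have : bern 0 b mu t^-1 = t^-1 * complex.Re (h (t^-1)%:C).
  have := gh (t^-1)%:C t0'; rewrite bernC_real => /(congr1 (@complex.Re R))/= ->.
  by case: (h _) => p q /=; ring.
move=> -> h1 h2.
rewrite -ler_pdivlMl//; apply: le_trans h2 _.
by rewrite mulrCA ler_pM2l// ler_pM2l.
Qed.

End bounded_rate.

(** * Complete monotonicity of Laplace transforms *)

Section complete_monotonicity.
Context {R : realType}.
Implicit Types (s t u v x y : R).

Local Notation P0 := (`[0%R, +oo[%classic : set R).

(** For [k > 0], split [e^{-uc}] into [k] equal factors; each [u e^{-uc/k}] is at most [k / c]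
    because [v <= e^v]. *)
Lemma pow_expRN_bound (c : R) (k : nat) : 0 < c ->
  exists C, forall u, 0 <= u -> u ^+ k * expR (- (u * c)) <= C.
Proof.
move=> c0; case: k => [|k].
  by exists 1 => u u0; rewrite expr0 mul1r -expR0 ler_expR oppr_le0 mulr_ge0// ltW.
exists ((k.+1%:R / c) ^+ k.+1) => u u0.
have -> : - (u * c) = k.+1%:R * - (u * c / k.+1%:R).
  by rewrite mulrN mulrCA divff ?mulr1// pnatr_eq0.
rewrite expRM_natl -exprMn lerXn2r ?nnegrE ?mulr_ge0 ?expR_ge0//.
  by rewrite invr_ge0 ltW.
rewrite expRN ler_pdivrMr ?expR_gt0// mulrC.
have := expR_ge1Dx (u * c / k.+1%:R) => h.
rewrite -ler_pdivrMr ?divr_gt0//.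
by apply: le_trans h; rewrite invf_div mulrA lerDr ler01.
Qed.

Lemma laplace_moment_integrable (m : {finite_measure set R -> \bar R}) (k : nat) c :
  0 < c -> m.-integrable P0 (EFin \o (fun s => s ^+ k * expR (- (s * c)))).
Proof.
move=> c0; have [C hC] := pow_expRN_bound c k c0.
apply: (continuous_bounded_integrable m C) => [s|u u0].
  apply: cvgM; first exact: exprn_continuous.
  apply: (continuous_comp (f := fun v => - (v * c))); last exact: continuous_expR.
  by apply: cvgN; apply: cvgM; [exact: cvg_id|exact: cvg_cst].
by rewrite ger0_norm ?hC// mulr_ge0 ?expR_ge0// exprn_ge0.
Qed.

(** For [y] in []x / 2, 2 x[] the derivative of the integrand is dominated by
    [s^(k+1) e^{-s x / 2}], which is integrable since [x / 2 > 0]. *)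
Lemma derive_laplace_moment (m : {finite_measure set R -> \bar R}) (k : nat) x : 0 < x ->
  let L j y := Rintegral m P0 (fun s => s ^+ j * expR (- (s * y))) in
  derivable (L k) x 1 /\ derive1 (L k) x = - L k.+1 x.
Proof.
move=> x0 L.
pose f y s := s ^+ k * expR (- (s * y)).
(* The absolute value makes [G] nonnegative on the whole line, as [G0] states. *)
pose G s := `|s| ^+ k.+1 * expR (- (s * (x / 2))).
have x20 : 0 < x / 2 by rewrite divr_gt0.
have d1 y s : is_derive y 1 (f ^~ s) (- (s ^+ k.+1 * expR (- (s * y)))).
  apply: is_derive_eq; rewrite /GRing.scale/= exprS; ring.
have d1E y s : partial1of2 f y s = - (s ^+ k.+1 * expR (- (s * y))).
  by rewrite partial1of2E; have [_ ->] := d1 y s.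
have Ix : (`]x / 2, (2 * x)[%classic : set R) x.
  by rewrite /= in_itv/=; apply/andP; split; lra.
have I0 y : (`]x / 2, (2 * x)[%classic : set R) y -> 0 < y.
  by rewrite /= in_itv/= => /andP[+ _]; exact: lt_trans.
have intf y : (`]x / 2, (2 * x)[%classic : set R) y -> m.-integrable P0 (EFin \o f y).
  by move=> /I0 y0; exact: laplace_moment_integrable.
have derf y s : (`]x / 2, (2 * x)[%classic : set R) y -> P0 s -> derivable (f ^~ s) y 1.
  by move=> _ _; have [] := d1 y s.
have G0 s : 0 <= G s by rewrite mulr_ge0 ?exprn_ge0 ?expR_ge0.
have iG : m.-integrable P0 (EFin \o G).
  have := laplace_moment_integrable m k.+1 _ x20.
  apply: eq_integrable => // s; rewrite inE/= in_itv/= andbT => s0.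
  by rewrite /G ger0_norm.
have Gub y s : (`]x / 2, (2 * x)[%classic : set R) y -> P0 s -> `|partial1of2 f y s| <= G s.
  rewrite /= !in_itv/= andbT => /andP[xy _] s0.
  rewrite d1E normrN normrM normrX ger0_norm// [`|expR _|]ger0_norm ?expR_ge0//.
  rewrite /G ger0_norm// ler_wpM2l ?exprn_ge0// ler_expR lerN2 ler_wpM2l// ltW//.
split.
  exact: (derivable_under_integral _ Ix intf derf G0 iG Gub).
rewrite (differentiation_under_integral _ Ix intf derf G0 iG Gub)//.
rewrite (@eq_Rintegral _ _ _ _ _ (fun s => -1 * (s ^+ k.+1 * expR (- (s * x))))).
  by rewrite RintegralZl ?mulN1r//; exact: laplace_moment_integrable.
by move=> s _; rewrite d1E mulN1r.
Qed.

(** The [n]-th derivative is [(-1)^n] times the nonnegative [L n]. As [h] is prescribed on [(0, oo)]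
    only, derivatives are compared through equality near each point. *)
Lemma completely_monotone_laplace (m : {finite_measure set R -> \bar R}) (h : R -> R) :
  (forall x, 0 < x -> h x = Rintegral m P0 (fun s => expR (- (s * x)))) ->
  completely_monotone h.
Proof.
move=> hE.
pose L j y := Rintegral m P0 (fun s => s ^+ j * expR (- (s * y))).
have near_pos x : 0 < x -> \forall y \near x, 0 < y by exact: lt_nbhsr.
have dE n x : 0 < x -> derive1n n h x = (-1) ^+ n * L n x.
  elim: n x => [|n IH] x x0.
    rewrite expr0 mul1r derive1n0 hE//.
    by apply: eq_Rintegral => s _; rewrite expr0 mul1r.
  rewrite derive1nS.
  have nE : {near x, derive1n n h =1 (fun y => (-1) ^+ n * L n y)}.
    by near=> y; apply: IH; near: y; exact: near_pos.
  rewrite derive1E (near_eq_derive _ nE)//.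
  have [dL LE] := derive_laplace_moment m n x x0.
  have {}LE : 'D_1 (L n) x = - L n.+1 x by rewrite -derive1E; exact: LE.
  rewrite deriveZ// LE exprS; move: (L n.+1 x) => l.
  by rewrite /GRing.scale/=; ring.
split=> n x x0.
  have nE : {near x, (fun y => (-1) ^+ n * L n y) =1 derive1n n h}.
    by near=> y; rewrite dE//; near: y; exact: near_pos.
  apply: (near_eq_derivable nE).
  have [dL _] := derive_laplace_moment m n x x0.
  exact: derivableZ.
rewrite dE// mulrA -exprMn mulrNN mulr1 expr1n mul1r.
apply: Rintegral_ge0 => s; rewrite /= in_itv/= andbT => s0.
by rewrite mulr_ge0 ?exprn_ge0 ?expR_ge0.
Unshelve. all: end_near. Qed.

End complete_monotonicity.

Theorem theorem3p2 (R : realType) (r : R -> R) :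
  (forall t : R, 0 < t -> 0 < r t) ->
  ( (* (i) <-> (ii) *)
    (exists (a b : R) (mu : {measure set R -> \bar R}),
       [/\ bernstein_triple a b mu,
           ~ (forall x : R, 0 < x -> bern a b mu x = 0) &
           forall t : R, 0 < t -> r t = rate a b mu t])
    <->
    [/\ forall t : R, 0 < t -> 0 < t * r t,
        forall s t : R, 0 < s -> s <= t -> s * r s <= t * r t &
        concave_pos (fun t => t * r t)] )
  /\
  (forall (a b : R) (mu : {measure set R -> \bar R}),
     bernstein_triple a b mu ->
     ~ (forall x : R, 0 < x -> bern a b mu x = 0) ->
     (forall t : R, 0 < t -> r t = rate a b mu t) ->
     [/\ (* (a) *)
         [/\ {in `]0, +oo[, continuous r},
             (forall s t : R, 0 < s -> s <= t -> r t <= r s) &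
             r x @[x --> +oo] --> a / 2],
         (* (b) *)
         (fun t => t * r t) x @[x --> 0^'+] --> b &
         (* (c) *)
         ((exists M : R, forall t : R, 0 < t -> t * r t <= M) <->
            (a = 0 /\ exists h : R[i] -> R[i],
               Wplus h /\ forall z : R[i], 0 < complex.Re z -> bernC a b mu z = z * h z))
         /\
         (forall h : R[i] -> R[i], a = 0 -> Wplus h ->
            (forall z : R[i], 0 < complex.Re z -> bernC a b mu z = z * h z) ->
            (forall x : R, 0 < x -> complex.Im (h x%:C) = 0) /\
            completely_monotone (fun x => complex.Re (h x%:C)))]).
Proof.
move=> r0; split; first split.
- move=> [a [b [mu [B _ rE]]]]; split.
  + by move=> t t0; rewrite mulr_gt0// r0.
  + move=> s t s0 st; rewrite !rE ?(lt_le_trans s0)//.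
    exact: mul_rate_le.
  + move=> x y l x0 y0 /[dup] l01 /andP[l0 l1].
    have z0 : 0 < l * x + (1 - l) * y by nra.
    by rewrite !rE//; exact: (concave_rate B).
- move=> [f0 finc fconc].
  have [a [b [mu [B fE]]]] := concave_rate_representation f0 finc fconc.
  have rE t : 0 < t -> r t = rate a b mu t.
    by move=> t0; apply: (mulfI (lt0r_neq0 t0)); exact: fE.
  (* A vanishing [bern] would give [r 1 <= 0] by [rate_le_bern] at [1]. *)
  exists a, b, mu; split=> // bern0.
  have := rate_le_bern 1 B ltr01; rewrite invr1 bern0// mulr0.
  by rewrite -rE// leNgt r0.
move=> a b mu B _ rE.
split; [split| |split].
- move=> x; rewrite in_itv/= andbT => x0; apply: continuous_of_nonincreasing_nondecreasingM => //.
  + by move=> s t s0 st; rewrite !rE ?(lt_le_trans s0)//; exact: rate_le.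
  + by move=> s t s0 st; rewrite !rE ?(lt_le_trans s0)//; exact: mul_rate_le.
- by move=> s t s0 st; rewrite !rE ?(lt_le_trans s0)//; exact: rate_le.
- apply: cvg_trans (cvg_rate_pinfty B); apply: near_eq_cvg; near=> t.
  by rewrite rE//; near: t; exact: nbhs_pinfty_gt.
- apply: cvg_trans (cvg_mul_rate_at_right B); apply: near_eq_cvg; near=> t.
  by rewrite rE//; near: t; exact: nbhs_right_gt.
- split.
    move=> [M rM]; have rM' t : 0 < t -> t * rate a b mu t <= M.
      by move=> t0; rewrite -rE// rM.
    have [a0 imu] := bounded_rate_integrable B rM'; split=> //; rewrite {}a0 in B *.
    have [m [mN mE]] := bernC_laplace B imu.
    exists (laplace m); split=> //.
    exact: Wplus_laplace.
  move=> [a0 [h [Wh gh]]]; rewrite a0 in B gh rE.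
  have [M hM] := bounded_rate_of_Wplus B Wh gh.
  by exists M => t t0; rewrite rE// hM.
(* For an arbitrary such [h], boundedness produces [m] with [g(z) = z (L m)(z)]; cancelling [x]
   identifies [h] with [L m] on the positive axis. *)
- move=> h a0 Wh gh; rewrite a0 in B gh.
  have [M hM] := bounded_rate_of_Wplus B Wh gh.
  have [_ imu] := bounded_rate_integrable B hM.
  have [m [mN mE]] := bernC_laplace B imu.
  have hE x : 0 < x -> h x%:C = (Rintegral m `[0%R, +oo[%classic (fun s => expR (- (s * x))))%:C.
    move=> x0; have x0' : x%:C != 0 :> R[i] by rewrite eq_complex /= gt_eqF.
    by apply: (mulfI x0'); rewrite -gh// mE// laplace_real.
  split; first by move=> x x0; rewrite hE.
  by apply: (completely_monotone_laplace m) => x x0; rewrite hE.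
Unshelve. all: end_near. Qed.
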